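(* Let $\mathbb X$ and $\mathbb Y$ be Banach spaces, $C\subseteq\mathbb X$ and $F:C\to\mathbb Y$ a continuous function, continuously differentiable on $\mathrm{int}(C)$. Take $x_0\in\mathrm{int}(C)$ with $F'(x_0)$ non-singular. Suppose there exist constants $L>0$ and $b>0$ such that $bL<1/2$, $B(x_0,1/L)\subset C$, \[\|F'(x_0)^{-1}[F'(y)-F'(x)]\|\le L\|x-y\|\quad\text{for all }x,y\in B(x_0,1/L),\] \[\|F'(x_0)^{-1}F(x_0)\|\le b,\qquad 0\le\theta\le\frac{1-\sqrt{2bL}}{1+\sqrt{2bL}}.\] Then the inexact Newton method with starting point $x_0$ and relative residual error tolerance $\theta$: for $k=0,1,\dots$, $x_{k+1}=x_k+S_k$ with $\|F'(x_0)^{-1}[F(x_k)+F'(x_k)S_k]\|\le\theta\|F'(x_0)^{-1}F(x_k)\|$, is well defined; any generated sequence satisfies $\|F'(x_0)^{-1}F(x_k)\|\le(\frac{1+\theta^2}{2})^kb$ for $k=0,1,\dots$, is contained in $B(x_0,\lambda)$, and converges to a point $x_*\in B[x_0,t_*]$ which is the unique zero of $F$ in $B(x_0,1/L)$, where $\lambda:=\sqrt{2bL}/L$ and $t_*:=(1-\sqrt{1-2Lb})/L$. Moreover, for $k=0,1,\dots$, \[\|x_*-x_{k+1}\|\le\Big[\frac{1+\theta}{2}\frac{L}{1-\sqrt{2bL}}\|x_*-x_k\|+\theta\,\frac{1+\sqrt{2bL}}{1-\sqrt{2bL}}\Big]\|x_*-x_k\|,\] and if additionally $0\le\theta<(1-\sqrt{2bL})/(5-\sqrt{2bL})$,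 then \[\|x_*-x_{k+1}\|\le\Big[\frac{1+\theta}{2}+\frac{2\theta}{1-\sqrt{2bL}}\Big]\|x_*-x_k\|,\qquad k=0,1,\dots.\]
   Context: $B(x,r)$, $B[x,r]$ denote open/closed balls of center $x$ and radius $r$. *)

(* Defs.v *)
From HB Require Import structures.
From mathcomp Require Import all_boot all_order all_algebra.
From mathcomp Require Import all_classical all_reals all_analysis.
Set Implicit Arguments. Unset Strict Implicit. Unset Printing Implicit Defensive.
Import Order.TTheory GRing.Theory Num.Theory.
Import numFieldNormedType.Exports.
Local Open Scope classical_set_scope.
Local Open Scope ring_scope.

Section defs.
Variables (R : realType) (X Y : completeNormedModType R).

(* F is continuously (Frechet) differentiable on the open set D: differentiable
   at every point of D, and x |-> F'(x) is continuous on D for the operator norm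
   (||F'(y) - F'(x)|| <= eps written as: forall v, ||(F'(y)-F'(x)) v|| <= eps ||v||). *)
Definition C1_on (F : X -> Y) (D : set X) : Prop :=
  (forall x, D x -> differentiable F x) /\
  (forall x, D x -> forall eps : R, 0 < eps -> exists2 delta : R, 0 < delta &
     forall y, D y -> `|y - x| < delta ->
       forall v : X, `|'d F y v - 'd F x v| <= eps * `|v|).

(* The inexact Newton condition at iterate xk with step S, relative residual
   tolerance theta, measured after applying T = F'(x0)^{-1}. *)
Definition inexact_newton_step (F : X -> Y) (T : Y -> X) (theta : R)
  (xk S : X) : Prop :=
  `|T (F xk + 'd F xk S)| <= theta * `|T (F xk)|.

Definition inexact_newton_seq (F : X -> Y) (T : Y -> X) (theta : R)
  (x0 : X) (x : nat -> X) : Prop :=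
  x 0%N = x0 /\
  forall k, inexact_newton_step F T theta (x k) (x k.+1 - x k).

Definition inexact_newton_prefix (F : X -> Y) (T : Y -> X) (theta : R)
  (x0 : X) (n : nat) (x : nat -> X) : Prop :=
  x 0%N = x0 /\
  forall k, (k < n)%N -> inexact_newton_step F T theta (x k) (x k.+1 - x k).

End defs.

(* Main.v *)
(* Put G := F'(x0)^-1 o F, so that G'(x0) = id and G' is L-Lipschitz on
   B(x0, 1/L); write beta := sqrt(2bL) and lambda := beta / L.  The majorant is
   the quadratic g(t) = L t^2 / 2 - beta t + b = (L / 2) (lambda - t)^2, i.e. the
   Kantorovich polynomial relaxed until lambda becomes a double root.  If
   |x - x0| <= t < lambda and |G x| <= g(t), then |G'(x)^-1| <= 1 / (1 - L t), so an
   inexact step has length at most s(t) := (1 + theta) g(t) / (1 - L t).  The bound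
   theta <= (1 - beta) / (1 + beta) says exactly that
   2 s(t) <= (1 - theta) (lambda - t) for all t in [0, lambda[, and this yields
   theta g(t) + L s(t)^2 / 2 <= g(t + s(t)): the pair of bounds propagates from t
   to t + s(t), so |x_k - x_j| <= t_k - t_j along the scalar sequence t_k.  The
   error bounds follow from
   G'(x_k)(x* - x_{k+1}) = [G x_k + G'(x_k)(x* - x_k)] - [G x_k + G'(x_k) S_k]. *)
Require Import Defs.
From HB Require Import structures.
From mathcomp Require Import all_boot all_order all_algebra.
From mathcomp Require Import all_classical all_reals all_analysis.
From mathcomp Require Import ring lra.
Import Order.TTheory GRing.Theory Num.Theory.
Import numFieldNormedType.Exports.
Local Open Scope classical_set_scope.
Local Open Scope ring_scope.

(** * Mean value inequality for normed-space-valued functions of a real variable *)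

Lemma le_of_locally_nonincreasing (R : realType) (g : R -> R) (a b : R) :
  a <= b ->
  (forall t, a <= t <= b -> {for t, continuous g}) ->
  (forall c, a <= c < b -> \forall t \near c^'+, g t <= g c) ->
  g b <= g a.
Proof.
move=> ab gcont gdec.
(* Continuity puts [sup S] itself in [S]; if it were smaller than [b], the decrease to its right
   would produce a larger element of [S]. *)
pose S := [set t | a <= t <= b /\ g t <= g a].
have Sa : S a by split; rewrite // lexx.
have ubS : ubound S b by move=> t [/andP[]].
have supS : has_sup S by split; [exists a | exists b].
have sup_ab : a <= sup S <= b.
  apply/andP; split; first exact: ub_le_sup supS.2 _ Sa.
  by apply: ge_sup => //; exists a.
have gsup : g (sup S) <= g a.
  rewrite leNgt; apply/negP => ga_lt.
  have := gcont _ sup_ab; move=> /cvgrPdist_lt /(_ (g (sup S) - g a)).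
  rewrite subr_gt0 => /(_ ga_lt)/nbhs_ballP[e /= e0 He].
  have [t St t_gt] := sup_adherent e0 supS.
  have t_le := ub_le_sup supS.2 St.
  have /= := He t; rewrite /ball /= ger0_norm ?subr_ge0// ltrBlDl -ltrBlDr.
  move=> /(_ t_gt).
  move=> /ltr_normlP[_]; rewrite ltrD2l ltrN2 ltNge.
  by move: St => -[_ ->].
have [supb|] := eqVneq (sup S) b; first by rewrite -supb.
move=> sup_neq.
have sup_lt : sup S < b by rewrite lt_neqAle sup_neq; case/andP: sup_ab.
have := gdec (sup S); rewrite sup_lt (andP sup_ab).1 => /(_ isT) dec.
near (sup S)^'+ => t.
have tS : S t.
  split.
    apply/andP; split.
      apply: le_trans (andP sup_ab).1 _.
      by apply: ltW; near: t; exact: nbhs_right_gt.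
    by near: t; exact: nbhs_right_le.
  by apply: le_trans gsup; near: t.
have := ub_le_sup supS.2 tS; rewrite leNgt => /negP[].
by near: t; exact: nbhs_right_gt.
Unshelve. all: by end_near. Qed.

Lemma derivable_right_dist (R : realType) (V : normedModType R) (f : R -> V)
    (c e : R) : derivable f c 1 -> 0 < e ->
  \forall t \near c^'+, `|f t - f c - (t - c) *: 'D_1 f c| <= e * (t - c).
Proof.
move=> df e0.
have : (fun h : R => h^-1 *: (f (h + c) - f c)) @ 0^' --> 'D_1 f c.
  have -> : (fun h : R => h^-1 *: (f (h + c) - f c)) =
            (fun h => h^-1 *: ((f \o shift c) (h *: 1) - f c)).
    by apply/funext => h /=; rewrite [h *: 1]mulr1.
  exact: df.
move=> /cvgrPdist_le /(_ e e0) /nbhs_ballP[d /= d0 Hd].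
near=> t.
have tc : c < t by near: t; exact: nbhs_right_gt.
have tc0 : 0 < t - c by rewrite subr_gt0.
have := Hd (t - c); rewrite /ball /= sub0r normrN gtr0_norm// subrK.
have td : t - c < d.
  by rewrite ltrBlDl; near: t; apply: nbhs_right_lt; rewrite ltrDl.
move=> /(_ td); rewrite gt_eqF// => /(_ isT) H.
rewrite -ler_pdivrMr// mulrC -[X in X * _]gtr0_norm ?invr_gt0//.
rewrite -normrZ scalerBr scalerA mulVf ?gt_eqF// scale1r distrC.
exact: H.
Unshelve. all: by end_near. Qed.

(** [|f t - f a|] need not be differentiable, so only right-sided first-order expansions of [f] and
    [g] are compared. A slack of slope [e'], costing [e] in total over the interval, absorbs their
    errors. *)
Lemma mean_value_le (R : realType) (V : normedModType R) (f : R -> V)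
    (g : R -> R) (a b : R) : a <= b ->
  (forall t, a <= t <= b -> derivable f t 1) ->
  (forall t, a <= t <= b -> derivable g t 1) ->
  (forall t, a <= t <= b -> `|'D_1 f t| <= 'D_1 g t) ->
  `|f b - f a| <= g b - g a.
Proof.
move=> ab df dg fg.
have [->|neq] := eqVneq a b; first by rewrite !subrr normr0.
have ba : 0 < b - a by rewrite subr_gt0 lt_neqAle neq.
apply/ler_addgt0Pr => e e0.
pose e' := e / (b - a).
have e'0 : 0 < e' by rewrite divr_gt0.
pose h t := `|f t - f a| - g t - e' * t.
suff : h b <= h a.
  rewrite /h subrr normr0.
  have : e' * (b - a) = e by rewrite divfK// gt_eqF.
  lra.
apply: le_of_locally_nonincreasing => // [t /[dup] tab|c /andP[ac cb]].
  move=> /dg/derivable1_diffP/differentiable_continuous gc.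
  have /derivable1_diffP/differentiable_continuous fc := df _ tab.
  apply: continuousB; first apply: continuousB => //.
    apply: cvg_norm; apply: cvgB => //; exact: cvg_cst.
  by apply: cvgM; [exact: cvg_cst | exact: cvg_id].
have cab : a <= c <= b by rewrite ac ltW.
(* Half of the slack pays for the expansion error of [f], half for that of [g]. *)
have e2 : 0 < e' / 2 by rewrite divr_gt0.
have := derivable_right_dist _ _ _ _ _ (df _ cab) e2.
have := derivable_right_dist _ _ _ _ _ (dg _ cab) e2.
have := fg _ cab.
move=> fgc dgc dfc.
near=> t.
have tc : 0 < t - c by rewrite subr_gt0; near: t; exact: nbhs_right_gt.
have /ler_normlP[H1 H2] :
  `|g t - g c - (t - c) * 'D_1 g c| <= e' / 2 * (t - c) by near: t.
have H3 : `|f t - f c - (t - c) *: 'D_1 f c| <= e' / 2 * (t - c) by near: t.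
have H4 : `|f t - f a| <= `|f t - f c - (t - c) *: 'D_1 f c|
    + (t - c) * `|'D_1 f c| + `|f c - f a|.
  rewrite -{2}(gtr0_norm tc) -normrZ.
  apply: le_trans (lerD (ler_normD _ _) (lexx _)).
  apply: le_trans (ler_normD _ _).
  by rewrite subrK addrA subrK.
have H5 : (t - c) * `|'D_1 f c| <= (t - c) * 'D_1 g c by rewrite ler_pM2l.
rewrite /h; lra.
Unshelve. all: by end_near. Qed.

(** * Increments along segments, and convergence under a scalar majorant *)

Lemma is_diff_is_derive (R : numFieldType) (V W : normedModType R)
    (f df : V -> W) (a v : V) : is_diff a f df -> is_derive a v f (df v).
Proof.
move=> fdf; have fa : differentiable f a by exact: ex_diff.
by apply: DeriveDef; [exact: diff_derivable | rewrite deriveE// diff_val].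
Qed.

(** Mean value inequality on the segment, with [p * t + q / 2 * t ^+ 2] as comparison function.
    Taking [p = 0] and [w = 'd G x (y - x)] gives the Taylor remainder; [q = 0] and [w = y - x]
    gives uniqueness of the zero. *)
Lemma increment_le (R : realType) (V W : normedModType R) (G : V -> W)
    (x y : V) (w : W) (p q : R) :
  (forall t : R, 0 <= t <= 1 -> differentiable G (x + t *: (y - x))) ->
  (forall t : R, 0 <= t <= 1 ->
     `|'d G (x + t *: (y - x)) (y - x) - w| <= p + q * t) ->
  `|G y - G x - w| <= p + q / 2.
Proof.
move=> dG leG.
pose f (t : R) := G (x + t *: (y - x)) - t *: w.
pose g (t : R) := p * t + q / 2 * t ^+ 2.
have fE (t : R) : 0 <= t <= 1 ->
    is_derive t 1 f ('d G (x + t *: (y - x)) (y - x) - w).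
  move=> t01.
  have dl (Z : normedModType R) (z : Z) : is_diff t ( *:%R ^~ z) ( *:%R ^~ z).
    exact: is_diff_scalel.
  have dGt : is_diff (x + t *: (y - x)) G ('d G (x + t *: (y - x))).
    by apply: differentiableP; exact: dG.
  have dline :
      is_diff t (fun t : R => x + t *: (y - x)) (fun t : R => t *: (y - x)).
    have := is_diffD (is_diff_cst x t) (dl V (y - x)).
    rewrite [X in is_diff _ _ X](_ : _ = *:%R ^~ (y - x)); last first.
      by apply/funext => u; rewrite fctE /= add0r.
    by [].
  have df := is_diffB (is_diff_comp dline dGt) (dl W w).
  have := is_diff_is_derive _ _ _ _ _ t (1 : R) df.
  by rewrite !fctE /= !scale1r.
have gE (t : R) : is_derive t 1 g (p + q * t).
  apply: is_derive_eq.
  by rewrite /GRing.scale /=; field.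
have -> : G y - G x - w = f 1 - f 0.
  by rewrite /f !scale0r !scale1r addr0 subr0 subrKC addrAC.
have -> : p + q / 2 = g 1 - g 0 by rewrite /g; field.
apply: mean_value_le; first exact: ler01; move=> t t01.
- by case: (fE t t01).
- by case: (gE t).
by have [_ ->] := fE t t01; have [_ ->] := gE t; exact: leG.
Qed.

Lemma segment_norm_le (R : realType) (X : normedModType R) (x0 x y : X)
    (t : R) : 0 <= t <= 1 ->
  `|x + t *: (y - x) - x0| <= Num.max `|x - x0| `|y - x0|.
Proof.
move=> /andP[t0 t1].
have -> : x + t *: (y - x) - x0 = (1 - t) *: (x - x0) + t *: (y - x0).
  rewrite scalerBl scale1r addrAC -[RHS]addrA; congr (_ + _).
  by rewrite [RHS]addrC -scalerBr opprB addrA subrK.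
apply: le_trans (ler_normD _ _) _; rewrite !normrZ !ger0_norm ?subr_ge0//.
set M := Num.max _ _.
have -> : M = (1 - t) * M + t * M by ring.
by apply: lerD; rewrite ler_wpM2l ?subr_ge0// le_max lexx ?orbT.
Qed.

(** The norms of the increments have bounded partial sums, since the increments of [t] telescope;
    completeness gives the limit, and the tail bound passes to it. *)
Lemma telescoping_bound_cvg (R : realType) (X : completeNormedModType R)
    (x : nat -> X) (t : nat -> R) (M : R) :
  (forall k, `|x k.+1 - x k| <= t k.+1 - t k) -> (forall k, t k <= M) ->
  exists2 xs, x @ \oo --> xs & forall k, `|xs - x k| <= M - t k.
Proof.
move=> xt tM.
have dist n k : `|x (k + n)%N - x k| <= t (k + n)%N - t k.
  elim: n => [|n IH]; first by rewrite addn0 !subrr normr0.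
  rewrite addnS; apply: le_trans (ler_distD (x (k + n)%N) _ _) _.
  have := xt (k + n)%N; move: IH; lra.
have cvgx : cvgn x.
  have -> : x = (cst (x 0%N) + series (telescope x)).
    apply/funext => n; rewrite seriesEnat /= fctE.
    by rewrite telescope_sumr// subrKC.
  apply: is_cvgD; first exact: is_cvg_cst.
  apply: normed_cvg; apply: nondecreasing_is_cvgn.
    by apply: nondecreasing_series => n _ _; exact: normr_ge0.
  exists (M - t 0%N) => _ [n _ <-]; rewrite /normed_series_of seriesEnat /=.
  apply: (@le_trans _ _ (\sum_(0 <= k < n) (t k.+1 - t k))).
    by apply: ler_sum => k _; exact: xt.
  by rewrite telescope_sumr// lerB.
exists (limn x) => // k.
have cvgk : `|x (n + k)%N - x k| @[n --> \oo] --> `|limn x - x k|.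
  apply: cvg_norm; apply: cvgB; last exact: cvg_cst.
  by rewrite (cvg_shiftn k).
apply: (cvgr_to_le cvgk); apply: nearW => n; rewrite addnC.
by apply: le_trans (dist n k) _; rewrite lerB.
Qed.

(** * Local estimates for a map whose derivative is Lipschitz and equals the identity at [x0] *)

Section lipschitz_derivative.
Variables (R : realType) (X : completeNormedModType R) (G : X -> X).
Variables (x0 : X) (L : R).
Hypothesis L_gt0 : 0 < L.
Hypothesis dG : forall x, `|x - x0| < 1 / L -> differentiable G x.
Hypothesis dG0 : forall v, 'd G x0 v = v.
Hypothesis dG_lip : forall x y, `|x - x0| < 1 / L -> `|y - x0| < 1 / L ->
  forall v, `|'d G y v - 'd G x v| <= L * `|x - y| * `|v|.

Lemma diff_sub_id_le x v : `|x - x0| < 1 / L ->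
  `|'d G x v - v| <= L * `|x - x0| * `|v|.
Proof.
move=> xB; have x0B : `|x0 - x0| < 1 / L by rewrite subrr normr0 divr_gt0.
by have := dG_lip _ _ x0B xB v; rewrite dG0 distrC (distrC x0) distrC.
Qed.

(** This is the bound 1 / (1 - L |x - x0|) on the inverse of ['d G x], phrased without the
    inverse. *)
Lemma diff_norm_ge x v : `|x - x0| < 1 / L ->
  (1 - L * `|x - x0|) * `|v| <= `|'d G x v|.
Proof.
move=> /(diff_sub_id_le x v); have := ler_distD ('d G x v) v 0.
by rewrite !subr0 distrC; lra.
Qed.

Lemma diff_norm_le x v : `|x - x0| < 1 / L ->
  `|'d G x v| <= (1 + L * `|x - x0|) * `|v|.
Proof.
move=> /(diff_sub_id_le x v); have := ler_distD v ('d G x v) 0.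
by rewrite !subr0; lra.
Qed.

Lemma taylor_remainder_le x y : `|x - x0| < 1 / L -> `|y - x0| < 1 / L ->
  `|G y - G x - 'd G x (y - x)| <= L / 2 * `|y - x| ^+ 2.
Proof.
move=> xB yB.
have segB (t : R) : 0 <= t <= 1 -> `|x + t *: (y - x) - x0| < 1 / L.
  by move=> /(segment_norm_le _ _ x0 x y) /le_lt_trans; apply; rewrite gt_max xB.
have -> : L / 2 * `|y - x| ^+ 2 = 0 + L * `|y - x| ^+ 2 / 2 by ring.
apply: increment_le => t t01; first exact/dG/segB.
apply: le_trans (dG_lip _ _ xB (segB _ t01) _) _.
rewrite opprD addNKr normrN normrZ ger0_norm; last by case/andP: t01.
by rewrite le_eqVlt; apply/orP; left; apply/eqP; ring.
Qed.

(** On the segment ['d G] is within [L * M < 1] of the identity, so the increment of [G] differs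
    from [y - x] by at most [L * M] times its norm. For two zeros the increment of [G] vanishes. *)
Lemma zero_unique x y : `|x - x0| < 1 / L -> `|y - x0| < 1 / L ->
  G x = 0 -> G y = 0 -> y = x.
Proof.
move=> xB yB Gx Gy.
pose M := Num.max `|x - x0| `|y - x0|.
have MB : M < 1 / L by rewrite gt_max xB.
have := @increment_le R X X G x y (y - x) (L * M * `|y - x|) 0.
rewrite Gx Gy subr0 sub0r normrN mul0r addr0 => H.
have {H} : `|y - x| <= L * M * `|y - x|.
  apply: H => t t01; have sB := segment_norm_le _ _ x0 x y _ t01.
    by apply: dG; apply: le_lt_trans sB MB.
  rewrite mul0r addr0.
  apply: le_trans (diff_sub_id_le _ _ (le_lt_trans sB MB)) _.
  by rewrite ler_wpM2r// ler_wpM2l// ltW.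
have LM : L * M < 1 by rewrite mulrC -ltr_pdivlMr.
rewrite -subr_le0 -{1}[`|_|]mul1r -mulrBl pmulr_rle0 ?subr_gt0//.
by rewrite normr_le0 subr_eq0 => /eqP.
Qed.

(** A solution is a fixed point of [v - 'd G x v + w], a contraction of ratio [L * |x - x0| < 1]
    because ['d G x] is that close to the identity. *)
Lemma diff_surjective x w : `|x - x0| < 1 / L -> exists v, 'd G x v = w.
Proof.
move=> xB.
pose f (v : X) : X := v - 'd G x v + w.
have funf : {homo f : v / setT v >-> setT v} by [].
pose ff : {fun [set: X] >-> [set: X]} := HB.pack f (isFun.Build _ _ _ _ _ funf).
have q0 : 0 <= L * `|x - x0| by rewrite mulr_ge0// ltW.
have q1 : L * `|x - x0| < 1 by rewrite mulrC -ltr_pdivlMr.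
have ctr : is_contraction ff.
  exists (NngNum q0); split => //= -[u v] _ /=.
  have -> : f u - f v = - ('d G x (u - v) - (u - v)).
    rewrite /f (linearB ('d G x)) [v - _ + w]addrC addrKA [RHS]opprB !opprB.
    by rewrite [LHS]addrACA [RHS]addrACA; congr (_ + _); exact: addrC.
  by rewrite normrN; exact: diff_sub_id_le.
have [v _ fv] := banach_fixed_point ctr closedT (ex_intro _ x0 I).
exists v; move: fv; rewrite /= /f -addrA => /eqP.
by rewrite -subr_eq0 opprD addNKr oppr_eq0 addrC subr_eq0 eq_sym => /eqP.
Qed.

(** In the last identity of the header the first bracket is a Taylor remainder at the zero [z], and
    the second is at most [theta * |G x|]. Bounding [|G x|] again through [z] brings in a second
    remainder, hence the factor [1 + theta], and the term in [1 + L * t]. *)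
Lemma newton_error_le (theta t : R) x S z : 0 <= theta ->
  `|x - x0| <= t -> t < 1 / L -> `|z - x0| < 1 / L -> G z = 0 ->
  `|G x + 'd G x S| <= theta * `|G x| ->
  (1 - L * t) * `|z - (x + S)| <=
    ((1 + theta) / 2 * L * `|z - x| + theta * (1 + L * t)) * `|z - x|.
Proof.
move=> th0 xt tB zB Gz Snewton.
have xB := le_lt_trans xt tB.
have tay : `|G x + 'd G x (z - x)| <= L / 2 * `|z - x| ^+ 2.
  by have := taylor_remainder_le _ _ xB zB; rewrite Gz sub0r -opprD normrN.
have Lxt : L * `|x - x0| <= L * t by rewrite ler_pM2l.
have lower : (1 - L * t) * `|z - (x + S)| <= `|'d G x (z - (x + S))|.
  apply: le_trans (diff_norm_ge _ _ xB).
  by rewrite ler_wpM2r// lerD2l lerN2.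
have upper : `|'d G x (z - x)| <= (1 + L * t) * `|z - x|.
  apply: le_trans (diff_norm_le _ _ xB) _.
  by rewrite ler_wpM2r// lerD2l.
have split : 'd G x (z - (x + S)) =
    (G x + 'd G x (z - x)) - (G x + 'd G x S).
  by rewrite opprD addrA (linearB ('d G x)) [G x + _]addrC addrKA.
have Gx_le : `|G x| <= `|G x + 'd G x (z - x)| + `|'d G x (z - x)|.
  by apply: le_trans (ler_normB _ _); rewrite addrK.
have := ler_normB (G x + 'd G x (z - x)) (G x + 'd G x S).
rewrite -split => tri.
have := ler_wpM2l th0 (le_trans Gx_le (lerD tay upper)).
lra.
Qed.

(** * The scalar majorant and its control of one inexact step *)

Variables (beta theta : R).
Hypothesis beta_gt0 : 0 < beta.
Hypothesis beta_lt1 : beta < 1.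
Hypothesis theta_ge0 : 0 <= theta.
Hypothesis theta_le : theta * (1 + beta) <= 1 - beta.

(* (1 + theta) g(t) / (1 - L t) for the majorant g of the header. *)
Definition majorant_step (t : R) : R :=
  (1 + theta) * (L / 2) * (beta / L - t) ^+ 2 / (1 - L * t).

Definition majorant_seq (k : nat) : R :=
  iter k (fun t => t + majorant_step t) 0.

Let theta_lt1 : theta < 1.
Proof.
by move: theta_le beta_gt0 (mulr_ge0 theta_ge0 (ltW beta_gt0)); lra.
Qed.

Let Llambda : L * (beta / L) = beta.
Proof. by rewrite mulrC divfK// gt_eqF. Qed.

Let lambda_lt : beta / L < 1 / L.
Proof. by rewrite ltr_pM2r ?invr_gt0. Qed.

(** The last inequality is the source: right minus left is [1 - beta - theta * (1 + beta) + 2 *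
    theta * L * t], nonnegative by the bound on [theta]. Multiplied by [beta / L - t], it gives the
    bound on twice the step. *)
Lemma majorant_step_bounds t : 0 <= t < beta / L ->
  [/\ 0 <= majorant_step t, 2 * majorant_step t <= (1 - theta) * (beta / L - t),
      (1 - L * t) * majorant_step t = (1 + theta) * (L / 2) * (beta / L - t) ^+ 2,
      0 < 1 - L * t &
      (1 + theta) * (L * (beta / L - t)) <= (1 - theta) * (1 - L * t)].
Proof.
move=> /andP[t0 tl].
have u0 : 0 < beta / L - t by rewrite subr_gt0.
have Lt : L * t < beta by rewrite -Llambda ltr_pM2l.
have Lt0 : 0 <= L * t by rewrite mulr_ge0// ltW.
have d0 : 0 < 1 - L * t by move: beta_lt1; lra.
have sE : (1 - L * t) * majorant_step t =
    (1 + theta) * (L / 2) * (beta / L - t) ^+ 2.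
  by rewrite /majorant_step mulrC divfK// gt_eqF.
have key : (1 + theta) * (L * (beta / L - t)) <= (1 - theta) * (1 - L * t).
  rewrite mulrBr Llambda.
  have : 0 <= theta * (L * t) by rewrite mulr_ge0.
  move: theta_le; lra.
split => //.
  by apply: divr_ge0 (ltW d0); rewrite mulr_ge0 ?sqr_ge0// mulr_ge0//;
    move: theta_ge0 L_gt0; lra.
rewrite -(ler_pM2l d0) mulrCA sE.
have := ler_wpM2r (ltW u0) key; lra.
Qed.

Lemma newton_step_majorized x S t : 0 <= t < beta / L ->
  `|x - x0| <= t -> `|G x| <= L / 2 * (beta / L - t) ^+ 2 ->
  `|G x + 'd G x S| <= theta * `|G x| ->
  let t' := t + majorant_step t in
  [/\ `|S| <= majorant_step t, `|x + S - x0| <= t', 0 <= t' < beta / L,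
      `|G (x + S)| <= L / 2 * (beta / L - t') ^+ 2 &
      `|G (x + S)| <= (1 + theta ^+ 2) / 2 * `|G x|].
Proof.
move=> tl xt Gx Snewton t'.
have [s0 s_le sE d0 key] := majorant_step_bounds t tl.
have {tl}[t0 tl] := andP tl.
have xB : `|x - x0| < 1 / L by apply: le_lt_trans xt (lt_trans tl lambda_lt).
have g0 := normr_ge0 (G x).
have n0 := normr_ge0 S.
have u0 : 0 < beta / L - t by rewrite subr_gt0.
have dS : (1 - L * t) * `|S| <= (1 + theta) * `|G x|.
  apply: (@le_trans _ _ `|'d G x S|).
    apply: le_trans (diff_norm_ge _ _ xB).
    by rewrite ler_wpM2r// lerD2l lerN2 ler_pM2l.
  have := ler_normB (G x + 'd G x S) (G x); rewrite addrAC subrr add0r; lra.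
have S_le : `|S| <= majorant_step t.
  rewrite -(ler_pM2l d0) sE; apply: le_trans dS _.
  by rewrite -mulrA ler_wpM2l// addr_ge0.
have s_lt : majorant_step t < beta / L - t.
  have := mulr_ge0 theta_ge0 (ltW u0); move: s_le; lra.
have t'l : 0 <= t' < beta / L by rewrite /t'; apply/andP; split; lra.
have xSt : `|x + S - x0| <= t'.
  by rewrite addrAC; apply: le_trans (ler_normD _ _) _; rewrite lerD.
have xSB : `|x + S - x0| < 1 / L.
  by apply: le_lt_trans xSt (lt_trans _ lambda_lt); case/andP: t'l.
have GS : `|G (x + S)| <= L / 2 * `|S| ^+ 2 + theta * `|G x|.
  have := taylor_remainder_le _ _ xB xSB.
  rewrite [x + S - x]addrAC subrr add0r => tay.
  apply: le_trans (lerD tay Snewton).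
  by apply: le_trans (ler_normD _ _); rewrite -[X in `|X + _|]addrA -opprD subrK.
split => //.
  (* With u = [beta / L - t], the target expands to L/2 (u^2 - 2 u s + s^2). The terms in s^2
     cancel, and what remains is 2 u s <= (1 - theta) u^2, which is [s_le] times u. *)
  apply: le_trans GS _; rewrite /t' opprD addrA.
  move: (majorant_step t) s0 s_le S_le s_lt => s s0 s_le S_le s_lt.
  have S2 : `|S| ^+ 2 <= s ^+ 2 by rewrite lerXn2r ?nnegrE.
  have := ler_wpM2l theta_ge0 Gx.
  have L2 : 0 <= L / 2 by rewrite divr_ge0// ltW.
  have := ler_wpM2l L2 S2.
  have := ler_wpM2l L2 (ler_wpM2r (ltW u0) s_le).
  lra.
apply: le_trans GS _.
(* Here (1 + theta^2)/2 - theta = (1 - theta)^2 / 2. One factor [|S|] is bounded by half of (1 -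
   theta) (beta / L - t), the other through [dS]; [key] then concludes, with a factor 2 to spare. *)
suff : L * `|S| ^+ 2 <= (1 - theta) ^+ 2 * `|G x| by lra.
rewrite -(ler_pM2l d0).
have Ln0 : 0 <= L * `|S| by rewrite mulr_ge0// ltW.
have S2 : 2 * `|S| <= (1 - theta) * (beta / L - t) by lra.
have := ler_wpM2l (mulr_ge0 (ltW d0) Ln0) S2.
have c0 : 0 <= L * (1 - theta) * (beta / L - t).
  by apply: mulr_ge0 (ltW u0); apply: mulr_ge0; [exact: ltW | rewrite subr_ge0 ltW].
have := ler_wpM2l c0 dS.
have c1 : 0 <= (1 - theta) * `|G x| by apply: mulr_ge0 g0; rewrite subr_ge0 ltW.
have := ler_wpM2r c1 key.
have := mulr_ge0 (mulr_ge0 (ltW d0) Ln0) n0.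
lra.
Qed.

Lemma majorant_seq_bounds k : 0 <= majorant_seq k < beta / L.
Proof.
elim: k => [|k IH] /=; first by rewrite lexx divr_gt0.
have [s0 s_le _ _ _] := majorant_step_bounds _ IH.
have {IH}[t0 tl] := andP IH.
rewrite -subr_gt0 in tl.
have := mulr_ge0 theta_ge0 (ltW tl).
move: (majorant_seq k) t0 tl s0 s_le => t t0 tl s0 s_le thu.
by rewrite addr_ge0//=; lra.
Qed.

(** * Iterates, location of zeros and convergence, from the initial residual bound *)

Hypothesis G0_le : `|G x0| <= L / 2 * (beta / L) ^+ 2.

(** Finite prefixes serve well-definedness, which concerns partially generated sequences. The
    residual condition is asked only at iterates in the ball, where ['d G] can be related to ['d F];
    the induction itself supplies membership. *)
Lemma newton_prefix_majorized (n : nat) (x : nat -> X) : x 0%N = x0 ->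
  (forall k, (k < n)%N -> `|x k - x0| < 1 / L ->
     `|G (x k) + 'd G (x k) (x k.+1 - x k)| <= theta * `|G (x k)|) ->
  forall k, (k <= n)%N ->
    [/\ `|x k - x0| <= majorant_seq k,
        `|G (x k)| <= L / 2 * (beta / L - majorant_seq k) ^+ 2 &
        `|G (x k)| <= ((1 + theta ^+ 2) / 2) ^+ k * (L / 2 * (beta / L) ^+ 2)].
Proof.
move=> xx0 xstep; elim=> [_|k IH kn].
  by rewrite xx0 subrr normr0 /majorant_seq /= subr0 expr0 mul1r.
have [xk Gxk Gxk_dec] := IH (ltnW kn).
have xB : `|x k - x0| < 1 / L.
  apply: le_lt_trans xk (lt_trans _ lambda_lt).
  by case/andP: (majorant_seq_bounds k).
have := newton_step_majorized _ _ _ (majorant_seq_bounds k) xk Gxk (xstep _ kn xB).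
rewrite subrKC => -[_ xk' _ Gxk' Gxk'_dec]; split => //.
apply: le_trans Gxk'_dec _; rewrite [_ ^+ k.+1]exprS -[leRHS]mulrA ler_wpM2l//.
by rewrite divr_ge0// addr_ge0// sqr_ge0.
Qed.

(** Taylor at [x0] makes the Kantorovich polynomial nonnegative at r = [|z - x0|], that is (1 - r
    L)^2 >= 1 - beta^2. Since r L < 1, taking square roots selects the smaller root. *)
Lemma newton_zero_dist z : `|z - x0| < 1 / L -> G z = 0 ->
  `|z - x0| <= (1 - Num.sqrt (1 - beta ^+ 2)) / L.
Proof.
move=> zB Gz.
have x0B : `|x0 - x0| < 1 / L by rewrite subrr normr0 divr_gt0.
have := taylor_remainder_le _ _ x0B zB; rewrite Gz sub0r dG0 => tay.
have : `|z - x0| <= L / 2 * `|z - x0| ^+ 2 + L / 2 * (beta / L) ^+ 2.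
  apply: le_trans (lerD tay G0_le).
  rewrite -[X in _ <= _ + X]normrN.
  by apply: le_trans (ler_normB _ _); rewrite opprK addrAC addNr sub0r normrN.
move: zB; rewrite ltr_pdivlMr// ler_pdivlMr//.
set r := `|z - x0|; move=> rL1 /(ler_wpM2l (ltW L_gt0)).
have -> : L * (L / 2 * r ^+ 2 + L / 2 * (beta / L) ^+ 2) =
    (r * L) ^+ 2 / 2 + beta ^+ 2 / 2.
  by rewrite -[X in _ = _ + X ^+ 2 / 2]Llambda; ring.
rewrite [L * r]mulrC => quad.
rewrite lerBrDr -lerBrDl -[1 - r * L]ger0_norm; last by rewrite subr_ge0 ltW.
by rewrite -sqrtr_sqr; apply: ler_wsqrtr; move: quad; lra.
Qed.

(** The limit exists by majorization of the increments. It is a zero because the residuals decay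
    geometrically, with ratio (1 + theta^2)/2 < 1, rather than through the limit of the majorant
    sequence. *)
Lemma inexact_newton_cvg (x : nat -> X) : x 0%N = x0 ->
  (forall k,
     `|G (x k) + 'd G (x k) (x k.+1 - x k)| <= theta * `|G (x k)|) ->
  exists2 z, x @ \oo --> z &
    [/\ G z = 0, forall k, `|z - x k| <= beta / L - majorant_seq k &
      forall k, (1 - L * majorant_seq k) * `|z - x k.+1| <=
        ((1 + theta) / 2 * L * `|z - x k| + theta * (1 + L * majorant_seq k))
        * `|z - x k|].
Proof.
move=> xx0 xstep.
have inv k : [/\ `|x k - x0| <= majorant_seq k,
    `|G (x k)| <= L / 2 * (beta / L - majorant_seq k) ^+ 2 &
    `|G (x k)| <= ((1 + theta ^+ 2) / 2) ^+ k * (L / 2 * (beta / L) ^+ 2)].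
  exact: (newton_prefix_majorized k _ xx0 (fun j _ _ => xstep j)).
have [z xz zx] : exists2 z, x @ \oo --> z &
    forall k, `|z - x k| <= beta / L - majorant_seq k.
  apply: telescoping_bound_cvg => k; last first.
    by case/andP: (majorant_seq_bounds k) => _ /ltW.
  have [xk Gxk _] := inv k.
  have [] := newton_step_majorized _ _ _ (majorant_seq_bounds k) xk Gxk (xstep k).
  by rewrite /majorant_seq /= [_ + majorant_step _]addrC addrK.
have zB : `|z - x0| < 1 / L.
  by have := zx 0%N; rewrite xx0 /majorant_seq /= subr0 => /le_lt_trans; apply.
have Gz : G z = 0.
  have Gxz : (G \o x) n @[n --> \oo] --> G z.
    apply: continuous_cvg xz; exact/differentiable_continuous/dG.
  suff Gx0 : (G \o x) n @[n --> \oo] --> 0.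
    exact: cvg_unique Gxz Gx0.
  have geo : ((1 + theta ^+ 2) / 2) ^+ n * (L / 2 * (beta / L) ^+ 2)
      @[n --> \oo] --> 0.
    under eq_fun do rewrite mulrC.
    apply: cvg_geometric.
    have th2 : 0 <= theta ^+ 2 < 1 by rewrite sqr_ge0 expr_lt1.
    by rewrite ger0_norm; lra.
  apply: norm_cvg0; apply: squeeze_cvgr (cvg_cst 0) geo.
  by apply: nearW => n /=; rewrite normr_ge0; case: (inv n).
exists z => //; split => // k.
have [xk _ _] := inv k.
rewrite -[x k.+1](subrKC (x k)).
apply: newton_error_le => //.
by case/andP: (majorant_seq_bounds k) => _ /lt_trans; apply.
Qed.

End lipschitz_derivative.

(** * Transfer of the estimates from the normalised map to [F] *)

Theorem theorem6p3 (R : realType) (X Y : completeNormedModType R)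
  (C : set X) (F : X -> Y) (x0 : X) (T : Y -> X) (L b theta : R) :
  {within C, continuous F} ->
  C1_on F (interior C) ->
  interior C x0 ->
  (* T = F'(x0)^{-1}: F'(x0) is non-singular with bounded inverse T *)
  cancel ('d F x0) T -> cancel T ('d F x0) -> continuous T ->
  0 < L -> 0 < b -> b * L < 1 / 2 ->
  (forall y, `|y - x0| < 1 / L -> C y) ->
  (forall x y, `|x - x0| < 1 / L -> `|y - x0| < 1 / L ->
     forall v : X, `|T ('d F y v - 'd F x v)| <= L * `|x - y| * `|v|) ->
  `|T (F x0)| <= b ->
  0 <= theta ->
  theta <= (1 - Num.sqrt (2 * b * L)) / (1 + Num.sqrt (2 * b * L)) ->
  (* well-definedness: every partially generated sequence can be continued *)
  (forall (n : nat) (x : nat -> X), inexact_newton_prefix F T theta x0 n x ->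
     interior C (x n) /\ exists S : X, inexact_newton_step F T theta (x n) S)
  /\
  (forall x : nat -> X, inexact_newton_seq F T theta x0 x ->
     (forall k : nat, `|T (F (x k))| <= ((1 + theta ^+ 2) / 2) ^+ k * b) /\
     (forall k : nat, `|x k - x0| < Num.sqrt (2 * b * L) / L) /\
     exists xs : X,
       x @ \oo --> xs /\
       `|xs - x0| <= (1 - Num.sqrt (1 - 2 * L * b)) / L /\
       F xs = 0 /\
       (forall y, `|y - x0| < 1 / L -> F y = 0 -> y = xs) /\
       (forall k : nat,
          `|xs - x k.+1| <=
            ((1 + theta) / 2 * (L / (1 - Num.sqrt (2 * b * L))) * `|xs - x k|
             + theta * ((1 + Num.sqrt (2 * b * L)) / (1 - Num.sqrt (2 * b * L))))
            * `|xs - x k|) /\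
       (theta < (1 - Num.sqrt (2 * b * L)) / (5 - Num.sqrt (2 * b * L)) ->
        forall k : nat,
          `|xs - x k.+1| <=
            ((1 + theta) / 2 + 2 * theta / (1 - Num.sqrt (2 * b * L)))
            * `|xs - x k|)).
Proof.
move=> _ [dF _] _ TK KT Tcont L0 b0 bL CB dF_lip TF0 th0.
have beta2 : Num.sqrt (2 * b * L) ^+ 2 = 2 * b * L.
  by rewrite sqr_sqrtr// !mulr_ge0// ltW.
have beta_gt0 : 0 < Num.sqrt (2 * b * L) by rewrite sqrtr_gt0 !mulr_gt0.
move: (Num.sqrt (2 * b * L)) beta2 beta_gt0 => beta beta2 beta_gt0.
have beta_lt1 : beta < 1.
  by rewrite -(@expr_lt1 _ 2)// ?ltW// beta2; lra.
rewrite ler_pdivlMr ?addr_gt0// => th_le.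
(* [T] is linear as the inverse of a linear map; with its continuity this makes [T] differentiable,
   so the chain rule applies to [G]. *)
have Tlin : linear T by exact: can2_linear TK KT.
pose TL : {linear Y -> X} := HB.pack T (GRing.isLinear.Build _ _ _ _ _ Tlin).
have intC y : `|y - x0| < 1 / L -> interior C y.
  move=> yB; apply: (@filterS _ _ _ (ball x0 (1 / L))) => [z|].
    by rewrite -ball_normE /= distrC; exact: CB.
  apply: open_nbhs_nbhs; split; first exact: ball_open.
  by rewrite -ball_normE /= distrC.
pose G := TL \o F.
have dTL y : differentiable TL y by exact: linear_differentiable.
have dG x : `|x - x0| < 1 / L -> differentiable G x.
  by move=> /intC/dF Fx; exact: differentiable_comp.
have dGE x v : `|x - x0| < 1 / L -> 'd G x v = T ('d F x v).
  move=> /intC/dF Fx; rewrite (diff_comp Fx (dTL (F x))).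
  by rewrite (@diff_lin _ _ _ TL).
have TD u v : T (u + v) = T u + T v by exact: (linearD TL).
have TB u v : T (u - v) = T u - T v by exact: (linearB TL).
have x0B : `|x0 - x0| < 1 / L by rewrite subrr normr0 divr_gt0.
have dG0 v : 'd G x0 v = v by rewrite dGE.
have dG_lip x y : `|x - x0| < 1 / L -> `|y - x0| < 1 / L ->
    forall v, `|'d G y v - 'd G x v| <= L * `|x - y| * `|v|.
  by move=> xB yB v; rewrite !dGE// -TB; exact: dF_lip.
(* [b] is the value at 0 of the majorant with double root [beta / L], so the initial residual bound
   is the invariant at t = 0. *)
have bE : b = L / 2 * (beta / L) ^+ 2.
  rewrite expr_div_n beta2; field; exact: lt0r_neq0.
have G0 : `|G x0| <= L / 2 * (beta / L) ^+ 2 by rewrite -bE.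
have tB k : 0 <= majorant_seq R L beta theta k < beta / L.
  exact: majorant_seq_bounds.
have lambda_lt : beta / L < 1 / L by rewrite ltr_pM2r ?invr_gt0.
have stepE x S : `|x - x0| < 1 / L -> inexact_newton_step F T theta x S ->
    `|G x + 'd G x S| <= theta * `|G x|.
  by move=> xB; rewrite dGE// -TD.
have inv n x : inexact_newton_prefix F T theta x0 n x -> forall k, (k <= n)%N ->
    `|x k - x0| < beta / L /\ `|G (x k)| <= ((1 + theta ^+ 2) / 2) ^+ k * b.
  move=> [xx0 xstep] k kn.
  have [|xk _ Gxk] := newton_prefix_majorized _ _ G x0 L L0 dG dG0 dG_lip beta theta
    beta_gt0 beta_lt1 th0 th_le G0 n x xx0 _ k kn.
    by move=> j jn xB; exact: stepE xB (xstep j jn).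
  split; first by apply: le_lt_trans xk _; case/andP: (tB k).
  by rewrite [X in _ * X]bE.
split=> [n x xpre|x [xx0 xstep]].
  have [/lt_trans/(_ lambda_lt) xB _] := inv n x xpre n (leqnn n).
  split; first exact: intC.
  (* The exact Newton step has zero residual, hence is admissible for every tolerance
     [theta >= 0]. *)
  have [S GS] := diff_surjective R X G x0 L L0 dG0 dG_lip _ (- G (x n)) xB.
  exists S; rewrite /inexact_newton_step TD -dGE// GS subrr normr0.
  by rewrite mulr_ge0.
have {}inv k := inv k x (conj xx0 (fun j _ => xstep j)) k (leqnn k).
have xB k : `|x k - x0| < 1 / L by exact: lt_trans (inv k).1 lambda_lt.
split; first by move=> k; exact: (inv k).2.
split; first by move=> k; exact: (inv k).1.
have [xs xxs [Gxs xst err]] := inexact_newton_cvg _ _ G x0 L L0 dG dG0 dG_lip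
  beta theta beta_gt0 beta_lt1 th0 th_le G0 x xx0
  (fun k => stepE _ _ (xB k) (xstep k)).
have xsB : `|xs - x0| < 1 / L.
  by have := xst 0%N; rewrite xx0 /majorant_seq /= subr0 => /le_lt_trans; apply.
have c0 : 0 < 1 - beta by rewrite subr_gt0.
have Llambda : L * (beta / L) = beta by rewrite mulrC divfK// gt_eqF.
exists xs; split=> //; split.
  have := newton_zero_dist _ _ G x0 L L0 dG dG0 dG_lip beta G0 xs xsB Gxs.
  by rewrite beta2 (mulrAC 2 b L).
split; first by rewrite -[LHS]KT -[T _]/(G xs) Gxs linear0.
split=> [y yB Fy|].
  apply: zero_unique xsB yB Gxs _ => //.
  by rewrite /G /comp Fy linear0.
(* As t_k < [beta / L], replacing t_k by this upper bound in [err] gives the first error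
   estimate. *)
have lower k : 1 - beta <= 1 - L * majorant_seq R L beta theta k.
  by rewrite lerD2l lerN2 -[leRHS]Llambda ler_pM2l// ltW//; case/andP: (tB k).
split=> [k|_ k].
  rewrite -(ler_pM2l c0).
  have -> : (1 - beta) * (((1 + theta) / 2 * (L / (1 - beta)) * `|xs - x k|
      + theta * ((1 + beta) / (1 - beta))) * `|xs - x k|) =
      ((1 + theta) / 2 * L * `|xs - x k| + theta * (1 + beta)) * `|xs - x k|.
    field; exact: lt0r_neq0.
  apply: le_trans (ler_wpM2r (normr_ge0 _) (lower k)) _.
  apply: le_trans (err k) _.
  rewrite ler_wpM2r// lerD2l ler_wpM2l//.
  by have := lower k; lra.
move: (err k) (lower k) (xst k).
set t := majorant_seq R L beta theta k; set e := `|xs - x k|.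
move=> errk dk et.
have e0 : 0 <= e by exact: normr_ge0.
have d0 := lt_le_trans c0 dk.
(* The second estimate keeps t: the distance to the limit is at most [beta / L - t], so the factor L
   e / (1 - L t) of the quadratic term is at most 1. *)
have Le : L * e <= 1 - L * t.
  apply: le_trans (ler_wpM2l (ltW L0) et) _.
  by rewrite mulrBr Llambda; lra.
rewrite -(ler_pM2l d0); apply: le_trans errk _.
rewrite [leRHS]mulrA ler_wpM2r// [leRHS]mulrDr; apply: lerD.
  by rewrite [leRHS]mulrC -[leLHS]mulrA ler_wpM2l ?divr_ge0 ?addr_ge0.
have -> : (1 - L * t) * (2 * theta / (1 - beta)) =
    theta * (2 * ((1 - L * t) / (1 - beta))) by ring.
rewrite ler_wpM2l//.
(* Since L t <= beta < 1, [1 + L * t] is at most 2, hence at most twice this ratio. *)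
have : 1 <= (1 - L * t) / (1 - beta) by rewrite ler_pdivlMr// mul1r.
have : 0 <= L * t by rewrite mulr_ge0 ?(ltW L0)//; case/andP: (tB k).
by move: beta_gt0 dk; lra.
Qed.
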